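(* For $m\ge 1$ let $r(m)$ be the number of $\approx$-equivalence classes of two-layer comparator networks on $m$ channels whose first layer is $F_m=\{(2i-1,2i):1\le i\le\lfloor m/2\rfloor\}$. Then for every odd $n\ge 3$, $r(n)=r(n-1)+2\,r(n-2)$.
   Context: A comparator network on $m$ channels is a sequence of layers; each layer is a set of comparators $(i,j)$, $1\le i<j\le m$, with each channel in at most one comparator of the layer. A two-layer network is one with exactly two layers $L_1;L_2$ (layers may contain any number of comparators, including none). Graph representation: $\mathcal G(C)$ has one vertex per comparator; for a comparator $u$ in layer $k$ and a comparator $v$ in a later layer, there is an edge labeled $1$ (resp. $2$) from $u$ to $v$ if the channel carrying the minimum (resp. maximum) output of $u$, namely its smaller (resp. larger) channel, is used by $v$ and by no comparator in a layer strictly between those of $u$ and $v$. $C_1\approx C_2$ means $\mathcal G(C_1)$ and $\mathcal G(C_2)$ are isomorphic as edge-labeled directed graphs. *)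

(* Defs.v *)
From mathcomp Require Import all_boot.

Set Implicit Arguments.
Unset Strict Implicit.
Unset Printing Implicit Defensive.

(* Channels 1, ..., m are represented by 'I_m, so channel k is the ordinal
   k - 1. A pair is an actual comparator when c.1 < c.2; this is enforced in
   [is_layer]. *)
Notation comparator m := ('I_m * 'I_m)%type.
Notation layer m := {set comparator m}.
Notation network m := (seq (layer m)).

Definition uses m (c : comparator m) (i : 'I_m) : bool :=
  (i == c.1) || (i == c.2).

Definition is_layer m (L : layer m) : bool :=
  [forall c in L, c.1 < c.2] && [forall i, #|[set c in L | uses c i]| <= 1].

Definition is_network m (C : network m) : bool := all (@is_layer m) C.

(* The edge label 1 is encoded by [false] and the label 2 by [true]. Two
   vertices may be joined by edges of both labels. *)
Record lgraph := LGraph { vert : finType; edge : bool -> rel vert }.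

Definition is_iso (G H : lgraph) (f : vert G -> vert H) : Prop :=
  bijective f /\ forall l u v, edge l (f u) (f v) = edge l u v.

Definition isomorphic (G H : lgraph) : bool :=
  [exists f : {ffun vert G -> vert H},
    [&& injectiveb f, [forall y, y \in codom f] &
        [forall l, forall u, forall v, edge l (f u) (f v) == edge l u v]]].

Lemma isomorphicP (G H : lgraph) :
  reflect (exists f : vert G -> vert H, is_iso f) (isomorphic G H).
Proof.
apply: (iffP existsP) => [[f /and3P[/injectiveP fI /forallP fS fE]]|[f [fB fE]]].
  exists f; split=> [|l u v].
    by exists (fun y => iinv (fS y)) => [x|y]; [apply: fI|]; rewrite f_iinv.
  by move/forallP/(_ l)/forallP/(_ u)/forallP/(_ v)/eqP: fE.
exists [ffun x => f x]; apply/and3P; split.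
- by apply/injectiveP=> x y; rewrite !ffunE; apply: (bij_inj fB).
- apply/forallP=> y; have [g _ gK] := fB.
  by apply/codomP; exists (g y); rewrite ffunE gK.
- by do 3!apply/forallP=> ?; rewrite !ffunE fE.
Qed.

Lemma isomorphic_refl G : isomorphic G G.
Proof. by apply/isomorphicP; exists id; split=> //; exists id. Qed.

Lemma isomorphic_sym G H : isomorphic G H = isomorphic H G.
Proof.
suff sub A B : isomorphic A B -> isomorphic B A by apply/idP/idP; apply: sub.
case/isomorphicP=> f [[g fK gK] fE]; apply/isomorphicP; exists g.
by split=> [|l u v]; [exists f | rewrite -fE !gK].
Qed.

Lemma isomorphic_trans G H K :
  isomorphic G H -> isomorphic H K -> isomorphic G K.
Proof.
case/isomorphicP=> f [fB fE] /isomorphicP[g [gB gE]].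
apply/isomorphicP; exists (g \o f); split; first exact: bij_comp.
by move=> l u v /=; rewrite gE fE.
Qed.

(* A comparator may occur in several layers, so a vertex records its layer. *)
Definition vertex m (C : network m) : finType :=
  {v : 'I_(size C) * comparator m | v.2 \in nth set0 C v.1}.

Definition vlayer m (C : network m) (v : vertex C) : nat := (val v).1.
Definition vcomp m (C : network m) (v : vertex C) : comparator m := (val v).2.

Definition out_channel m (l : bool) (c : comparator m) : 'I_m :=
  if l then c.2 else c.1.

Definition network_edge m (C : network m) (l : bool) : rel (vertex C) :=
  fun u v =>
    let i := out_channel l (vcomp u) in
    [&& vlayer u < vlayer v, uses (vcomp v) i &
        [forall w : vertex C,
          (vlayer u < vlayer w < vlayer v) ==> ~~ uses (vcomp w) i]].

Definition network_graph m (C : network m) : lgraph :=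
  LGraph (@network_edge m C).

Definition approx m (C1 C2 : network m) : bool :=
  isomorphic (network_graph C1) (network_graph C2).

Lemma approx_equiv m : equivalence_rel (@approx m).
Proof.
apply/equivalence_relP; split=> [C|C1 C2 C12 C3]; first exact: isomorphic_refl.
apply/idP/idP; last exact: isomorphic_trans.
by apply: isomorphic_trans; rewrite isomorphic_sym.
Qed.

(* With channels counted from 0, the pair (2i-1, 2i) becomes (2i-2, 2i-1). *)
Definition first_layer m : layer m :=
  [set c : comparator m | ~~ odd c.1 & c.2 == c.1.+1 :> nat].

Definition two_layer_networks m : {set 2.-tuple (layer m)} :=
  [set C : 2.-tuple (layer m) | is_network C & tnth C ord0 == first_layer m].

Definition r (m : nat) : nat :=
  #|equivalence_partition (fun C1 C2 : 2.-tuple (layer m) => approx C1 C2)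
      (two_layer_networks m)|.

(* Main.v *)
(* The second layer of a two-layer network is a partial matching of the ends of
   the k = m./2 first-layer comparators (blocks), plus one free port when m is
   odd. Comparators of layer 2 are the vertices with an incoming edge, so the
   graph determines, and is determined by, this matching up to a permutation of
   the blocks. For odd n, the free port is either unmatched, leaving a matching
   for n - 1 channels, or matched to end l of some block; deleting that block
   turns its other end into the free port of a matching for n - 2 channels, with
   two choices for l. *)
Require Import Defs.
From mathcomp Require Import all_boot all_fingroup.

Set Implicit Arguments.
Unset Strict Implicit.
Unset Printing Implicit Defensive.

(** * Counting the classes of an equivalence relation that meet a finite set *)

(** Classes are taken in all of [T], not cut down to [D], so the class of a point does not depend on
    [D] and a union of domains gives a union of families. *)
Definition classes_of (T : finType) (R : rel T) (D : {set T}) : {set {set T}} :=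
  [set [set y | R x y] | x in D].

(** Both images are the quotient of [D] by the same kernel. By symmetry one inequality suffices, and
    it holds because [g] factors through [h] on [D] via a choice of preimages. *)
Lemma eq_card_imset (T A B : finType) (D : {set T}) (g : T -> A) (h : T -> B) :
    {in D &, forall x y, (g x == g y) = (h x == h y)} ->
  #|g @: D| = #|h @: D|.
Proof.
move=> gh.
wlog suff le : A B g h gh / #|g @: D| <= #|h @: D|.
  by apply/eqP; rewrite eqn_leq !le // => x y xD yD; rewrite gh.
have [->|[x0 x0D]] := set_0Vmem D; first by rewrite imset0 cards0.
(* The default [x0] is never returned on [h @: D], where the search succeeds. *)
pose k a := odflt x0 [pick x in D | h x == a].
have kP x : x \in D -> k (h x) \in D /\ h (k (h x)) = h x.
  move=> xD; rewrite /k; case: pickP => [y /andP[yD /eqP]|/(_ x)] //=.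
  by rewrite xD eqxx.
suff -> : g @: D = (g \o k) @: (h @: D) by apply: leq_imset_card.
rewrite -imset_comp; apply: eq_in_imset => x xD /=.
by have [kD hk] := kP x xD; apply/eqP; rewrite gh // hk.
Qed.

Lemma eq_class (T : finType) (R : rel T) : equivalence_rel R ->
  forall x y, ([set z | R x z] == [set z | R y z]) = R x y.
Proof.
move=> /equivalence_relP[Rxx Rl] x y; apply/eqP/idP => [/setP/(_ y)|Rxy].
  by rewrite !inE Rxx.
by apply/setP=> z; rewrite !inE (Rl _ _ Rxy).
Qed.

Lemma card_equivalence_partition (T : finType) (R : rel T) (D : {set T}) :
  equivalence_rel R -> #|equivalence_partition R D| = #|classes_of R D|.
Proof.
move=> Req; apply: eq_card_imset => x y xD yD.
rewrite eq_class //; move/equivalence_relP: Req => [Rxx Rl].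
apply/eqP/idP => [/setP/(_ y)|Rxy]; first by rewrite !inE Rxx yD.
by apply/setP=> z; rewrite !inE (Rl _ _ Rxy).
Qed.

(** The map [h] induces a bijection on classes, so it has to be onto only up to [R']. *)
Lemma card_classes_of (T T' : finType) (R : rel T) (R' : rel T')
    (D : {set T}) (D' : {set T'}) (h : T -> T') :
    equivalence_rel R -> equivalence_rel R' ->
    {in D, forall x, h x \in D'} ->
    {in D &, forall x y, R' (h x) (h y) = R x y} ->
    {in D', forall y, exists2 x, x \in D & R' (h x) y} ->
  #|classes_of R D| = #|classes_of R' D'|.
Proof.
move=> Req Req' hD hR hS.
have -> : classes_of R' D' = (fun x => [set y | R' (h x) y]) @: D.
  apply/setP=> A; apply/imsetP/imsetP => -[x xD ->]; last by exists (h x); auto.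
  have [y yD Ryx] := hS x xD; exists y => //.
  by apply/eqP; rewrite eq_sym eq_class.
by apply: eq_card_imset => x y xD yD; rewrite !eq_class // hR.
Qed.

Lemma card_classes_ofU (T : finType) (R : rel T) (D1 D2 : {set T}) :
    equivalence_rel R -> {in D1 & D2, forall x y, ~~ R x y} ->
  #|classes_of R (D1 :|: D2)| = #|classes_of R D1| + #|classes_of R D2|.
Proof.
move=> Req R12; rewrite {1}/classes_of imsetU cardsU.
have -> : classes_of R D1 :&: classes_of R D2 = set0; last by rewrite cards0 subn0.
apply/setP=> A; rewrite !inE; apply/negP=> /andP[/imsetP[x xD ->]].
by case/imsetP=> y yD /eqP; rewrite eq_class // (negbTE (R12 x y xD yD)).
Qed.

(** * Matchings of ports, their graphs, and isomorphism as conjugacy *)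

(** Both kinds of graph have a subtype as vertex set. Giving [h] on the ambient types and
    quantifying over [u'], [v'] by their values keeps membership proofs out of the edge
    condition. *)
Lemma isomorphic_sig (X Y : finType) (P : pred X) (Q : pred Y)
    (eX : bool -> rel {x | P x}) (eY : bool -> rel {y | Q y}) (h : X -> Y) :
    (forall x, P x -> Q (h x)) -> {in P &, injective h} ->
    (forall y, Q y -> exists2 x, P x & h x = y) ->
    (forall l u v u' v', val u' = h (val u) -> val v' = h (val v) ->
       eY l u' v' = eX l u v) ->
  isomorphic (LGraph eX) (LGraph eY).
Proof.
move=> hQ hI hS hE; apply/isomorphicP.
pose F (u : {x | P x}) : {y | Q y} := Sub (h (val u)) (hQ _ (valP u)).
exists F; split; last by move=> l u v; apply: hE; rewrite SubK.
have FI : injective F.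
  by move=> u v /(congr1 val); rewrite !SubK => /hI/val_inj; apply; apply: valP.
have FS (y : {y | Q y}) : exists u, F u == y.
  have [x Px hx] := hS _ (valP y).
  by exists (Sub x Px); rewrite -val_eqE !SubK hx.
exists (fun y => xchoose (FS y)) => [u|y]; last exact/eqP/(xchooseP (FS y)).
by apply: FI; apply/eqP/(xchooseP (FS (F u))).
Qed.

(* [Some (b, l)] is the output labelled [l] of block [b]; [None] is the channel
   that the first layer does not use, which exists only for odd [m]. *)
Notation port B := (option (B * bool)%type).
Notation matching B := {ffun port B -> port B}.

(* A matching is an involution whose fixed points are the unmatched ports. For
   even [m] ([o = false]) the missing port [None] has to be fixed. *)
Definition matchings (B : finType) (o : bool) : {set matching B} :=
  [set f : matching B | [forall e, f (f e) == e] & o || (f None == None)].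

(** [inl b] stands for a first-layer comparator, [inr A] for a second-layer one, seen as the
    unordered pair of ports it joins. *)
Definition is_mvertex (B : finType) (f : matching B) (x : B + {set port B}) : bool :=
  if x is inr A then [exists e, (f e != e) && (A == [set e; f e])] else true.

Definition medge (B : finType) (f : matching B) (l : bool) :
    rel {x | is_mvertex f x} :=
  fun u v => match val u, val v with inl b, inr A => Some (b, l) \in A | _, _ => false end.
Definition mgraph (B : finType) (f : matching B) : lgraph := LGraph (medge (f := f)).

Definition port_map (A B : Type) (s : A -> B) (e : port A) : port B :=
  omap (fun p => (s p.1, p.2)) e.

Lemma port_map_inj (A B : Type) (s : A -> B) :
  injective s -> injective (port_map s).
Proof. by move=> sI [[a c]|] [[b d]|] //= [/sI-> ->]. Qed.

Section Mgraph.
Variable B : finType.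
Implicit Types (f g : matching B) (s : {perm B}).

Lemma port_mapKV s : cancel (port_map s^-1%g) (port_map s).
Proof. by case=> [[b l]|] //=; rewrite permKV. Qed.

Lemma mvertex_block_subproof f b : is_mvertex f (inl b). Proof. by []. Qed.
Definition mblock f b : vert (mgraph f) := exist (is_mvertex f) _ (mvertex_block_subproof f b).

(** A matched pair contains at least one block end, since its two ports differ and only one port is
    free. With [edge_mblock], blocks are thus exactly the vertices without incoming edges. *)
Lemma mvertex_target f (v : vert (mgraph f)) :
  (exists b, v = mblock f b) \/ (exists u l, edge l u v).
Proof.
case: v => -[b|A] vP; first by left; exists b; apply: val_inj.
right; case/existsP: (vP) => -[[b l]|] /andP[fe /eqP EA].
  by exists (mblock f b), l; rewrite /= /medge /= EA !inE eqxx.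
move: fe; case fN: (f None) => [[b l]|] // _.
by exists (mblock f b), l; rewrite /= /medge /= EA fN !inE eqxx orbT.
Qed.

Lemma edge_mblock f l u b : edge l u (mblock f b) = false.
Proof. by case: u => -[]. Qed.

(* Recovers [f] on block ends from the graph; the case [p = q] tells which ends
   are matched at all. *)
Lemma common_target f (p q : B * bool) : f \in matchings B true ->
  reflect (exists v, edge p.2 (mblock f p.1) v && edge q.2 (mblock f q.1) v)
    ((f (Some p) != Some p) && ((q == p) || (f (Some p) == Some q))).
Proof.
case: p q => [b l] [c m]; rewrite inE => /andP[/forallP fK _]; apply: (iffP idP); last first.
  case=> -[[//|A] vP]; rewrite /= /medge /=; case/existsP: (vP) => e /andP[fe /eqP ->].
  rewrite !inE; move: (fK e) fe => /eqP ffe fe.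
  case/andP=> /orP[]/eqP Ep /orP[]/eqP Eq; rewrite ?Ep ?Eq.
  - by rewrite fe -(inj_eq Some_inj) Ep Eq eqxx.
  - by rewrite fe eqxx orbT.
  - by rewrite ffe eq_sym fe eqxx orbT.
  - by rewrite ffe eq_sym fe -(inj_eq Some_inj) Ep Eq eqxx.
case/andP=> fe E.
have vP : is_mvertex f (inr [set Some (b, l); f (Some (b, l))]).
  by apply/existsP; exists (Some (b, l)); rewrite fe eqxx.
exists (exist (is_mvertex f) _ vP); rewrite /= /medge /= !inE eqxx /=.
by case/orP: E => /eqP->; rewrite eqxx ?orbT.
Qed.

Lemma conj_isomorphic f g s :
  (forall e, g (port_map s e) = port_map s (f e)) -> isomorphic (mgraph f) (mgraph g).
Proof.
move=> sP; have sI := port_map_inj (@perm_inj _ s).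
pose h (x : B + {set port B}) : B + {set port B} :=
  match x with inl b => inl (s b) | inr A => inr [set port_map s e | e in A] end.
apply: (isomorphic_sig (h := h)).
- case=> [//|A] /existsP[e /andP[fe /eqP->]]; apply/existsP.
  exists (port_map s e); rewrite sP inj_eq // fe /=.
  by rewrite imsetU !imset_set1.
- by move=> [b|A] [c|A'] _ _ //= [] => [/perm_inj->|/(imset_inj sI)->].
- case=> [b _|A /existsP[e /andP[ge /eqP->]]].
    by exists (inl (s^-1%g b)) => //=; rewrite permKV.
  pose d := port_map s^-1%g e; have Ee : e = port_map s d by rewrite port_mapKV.
  exists (inr [set d; f d]) => /=; last by rewrite imsetU !imset_set1 -sP -Ee.
  by apply/existsP; exists d; rewrite eqxx andbT -(inj_eq sI) -sP -Ee.
- move=> l u v u' v' Eu Ev; rewrite /medge Eu Ev.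
  case: (val u) (val v) => [b|//] [//|A] /=.
  by rewrite -[Some (s b, l)]/(port_map s (Some (b, l))) mem_imset.
Qed.

(** An isomorphism preserves the absence of incoming edges, so it permutes the blocks, and it
    respects common targets, which determine the matching on block ends. The value at the free port
    then follows by involutivity. *)
Lemma isomorphic_conj f g :
    f \in matchings B true -> g \in matchings B true ->
    isomorphic (mgraph f) (mgraph g) ->
  exists s : {perm B}, forall e, g (port_map s e) = port_map s (f e).
Proof.
move=> fM gM /isomorphicP[phi [phiB phiE]].
have phi_inj := bij_inj phiB; have [psi phiK psiK] := phiB.
have bl b : exists c, phi (mblock f b) == mblock g c.
  case: (mvertex_target (phi (mblock f b))) => [[c ->]|[u [l]]]; first by exists c.
  by rewrite -(psiK u) phiE edge_mblock.
pose s0 b := xchoose (bl b).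
have s0P b : phi (mblock f b) = mblock g (s0 b) by apply/eqP/(xchooseP (bl b)).
have s0I : injective s0.
  by move=> b c E; have := s0P b; rewrite E -s0P => /phi_inj[].
pose s := perm s0I; pose S (p : B * bool) := (s p.1, p.2).
have sP b : phi (mblock f b) = mblock g (s b) by rewrite permE.
exists s.
have SI : injective S by move=> [b l] [c m] [/perm_inj-> ->].
have sS q : exists p, q = S p by exists (s^-1%g q.1, q.2); rewrite /S /= permKV; case: q.
have J p q : (f (Some p) != Some p) && ((q == p) || (f (Some p) == Some q)) =
    (g (Some (S p)) != Some (S p)) &&
       ((S q == S p) || (g (Some (S p)) == Some (S q))).
  apply/(common_target _ _ fM)/(common_target _ _ gM) => -[v vP].
    by exists (phi v); rewrite -(sP p.1) -(sP q.1) !phiE.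
  by exists (psi v); rewrite -!phiE (sP p.1) (sP q.1) psiK.
have gS p : g (Some (S p)) = port_map s (f (Some p)).
  have := J p p; rewrite !eqxx !andbT; case: eqP => [-> /esym/eqP //|/eqP fp /esym gp].
  have Jp q : (q == p) || (f (Some p) == Some q) =
     (S q == S p) || (g (Some (S p)) == Some (S q)) by have := J p q; rewrite fp gp.
  case fpE: (f (Some p)) => [q|].
    have := Jp q; rewrite fpE eqxx orbT => /esym /orP[/eqP/SI E|/eqP //].
    by rewrite fpE E eqxx in fp.
  (* Here [f] matches [p] to the free port; were [g] to match [S p] to a block end [S q'], then [p]
     and [q'] would have a common target, forcing [q' = p]. *)
  case gpE: (g (Some (S p))) => [q|//]; have [q' Eq] := sS q.
  have := Jp q'; rewrite fpE gpE Eq eqxx !orbT orbF => /eqP E.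
  by rewrite gpE Eq E eqxx in gp.
move: fM gM; rewrite !inE !andbT => /forallP fK /forallP gK.
case=> [p|] /=; first exact: gS.
case fN: (f None) => [p|].
  have := gS p; rewrite -fN (eqP (fK _)) /= => gp.
  by rewrite fN -{1}gp (eqP (gK _)).
case gN: (g None) => [q|//]; have [p Eq] := sS q.
have := gS p; rewrite -Eq -gN (eqP (gK _)); case fp: (f (Some p)) => // _.
by have := eqP (fK (Some p)); rewrite fp fN.
Qed.

End Mgraph.

Definition miso (B : finType) (f g : matching B) := isomorphic (mgraph f) (mgraph g).

Lemma miso_equiv (B : finType) : equivalence_rel (@miso B).
Proof.
apply/equivalence_relP; split=> [f|f g fg h]; first exact: isomorphic_refl.
apply/idP/idP; last exact: isomorphic_trans.
by apply: isomorphic_trans; rewrite isomorphic_sym.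
Qed.

Lemma matchingsT (B : finType) (o : bool) :
  {subset matchings B o <= matchings B true}.
Proof. by move=> f; rewrite !inE => /andP[-> _]. Qed.

(** * Two-layer networks as matchings of ports *)

Section Channels.
Variables (B : finType) (o : bool).
Local Notation m := (o + #|B|.*2).

(** Channel [2j + l] carries output [l] of the [j]-th block; [insub] fails only on the last channel
    when the number of channels is odd. *)
Definition channel_port (i : 'I_m) : port B :=
  if insub i./2 is Some j then Some (enum_val (j : 'I_#|B|), odd i) else None.

Variant channel_port_spec (i : 'I_m) : port B -> Type :=
  | ChannelBlock b (l : bool) of i = l + (enum_rank b).*2 :> nat :
      channel_port_spec i (Some (b, l))
  | ChannelFree of o & i = #|B|.*2 :> nat : channel_port_spec i None.

Lemma channel_portP i : channel_port_spec i (channel_port i).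
Proof.
rewrite /channel_port; case: insubP => [j _ Ej|].
  by constructor; rewrite enum_valK Ej odd_double_half.
rewrite -leqNgt => le.
suff [o1 iE] : o /\ i = #|B|.*2 :> nat by constructor.
move: (nat_of_ord i) (ltn_ord i) le => n lt le.
have {}le : #|B|.*2 <= n by rewrite -(odd_double_half n) (leq_trans _ (leq_addl _ _)) ?leq_double.
case: (o) lt => /=; last by rewrite ltnNge le.
by rewrite add1n ltnS => ge; split=> //; apply/eqP; rewrite eqn_leq ge.
Qed.

Lemma channel_port_inj : injective channel_port.
Proof.
move=> i j E; apply: ord_inj.
by case: (channel_portP i) (channel_portP j) E => [b l ->|_ ->] [c k ->|_ ->] // [-> ->].
Qed.

Lemma channel_port_onto e : o || (e != None) -> exists i, channel_port i = e.
Proof.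
case: e => [[b l] _|].
  have lt : l + (enum_rank b).*2 < m.
    apply: (@leq_trans (#|B|.*2)); last exact: leq_addl.
    apply: (@leq_trans (enum_rank b).+1.*2); last by rewrite leq_double.
    by rewrite doubleS ltnS -add1n leq_add2r; case: l.
  exists (Ordinal lt); rewrite /channel_port /=.
  have -> : (l + (enum_rank b).*2)./2 = enum_rank b by rewrite half_bit_double.
  rewrite valK enum_rankK oddD odd_double addbF.
  by case: l lt.
rewrite orbF => o1; have lt : #|B|.*2 < m by rewrite o1.
exists (Ordinal lt); rewrite /channel_port /= doubleK.
by case: insubP => // j; rewrite ltnn.
Qed.

Lemma mem_first_layer (c : comparator m) :
  c \in first_layer m <->
  exists b, channel_port c.1 = Some (b, false) /\ channel_port c.2 = Some (b, true).
Proof.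
rewrite inE; split.
  case/andP=> ev /eqP E2; move: ev E2 (ltn_ord c.2).
  case: (channel_portP c.1) => [b l E|o1 ->].
    rewrite E oddD odd_double addbF; case: l E => //= E _ E2 _.
    exists b; split=> //; case: (channel_portP c.2) => [d l E'|_ E'].
      move: (congr1 odd E') (congr1 half E').
      rewrite half_bit_double E2 add0n /= uphalf_double oddD !odd_double addbF oddb.
      by move=> /esym-> /ord_inj/enum_rank_inj->.
    by move: (congr1 odd E'); rewrite E2 /= !odd_double.
  (* The free channel is the last one, so it has no successor. *)
  by move=> _ -> lt; exfalso; move: lt; rewrite o1 ltnn.
case=> b [].
case: (channel_portP c.1) => [d l E1|//] [Ed El]; rewrite Ed El in E1.
case: (channel_portP c.2) => [d' l' E2|//] [Ed' El']; rewrite Ed' El' in E2.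
by rewrite E1 E2 odd_double eqxx.
Qed.

(** The condition [c.1 < c.2] selects one orientation of each matched pair and excludes the fixed
    points of [f]. *)
Definition matching_layer (f : matching B) : layer m :=
  [set c : comparator m | c.1 < c.2 & f (channel_port c.1) == channel_port c.2].

Definition matching_network (f : matching B) : 2.-tuple (layer m) :=
  [tuple first_layer m; matching_layer f].

Lemma is_layer_first : is_layer (first_layer m).
Proof.
apply/andP; split; apply/forallP=> x.
  by apply/implyP; rewrite inE => /andP[_ /eqP->].
apply/card_le1_eqP=> c d; rewrite !inE /uses.
case/andP=> /andP[c1 /eqP c2] cx /andP[/andP[d1 /eqP d2] dx].
have E1 : c.1 = d.1.
  apply: ord_inj.
  case/orP: cx dx => /eqP-> /orP[] /eqP E //; move: (congr1 (@nat_of_ord m) E).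
  - by move=> ->.
  - by rewrite d2 => E'; move: c1; rewrite E' /= d1.
  - by rewrite c2 => E'; move: d1; rewrite -E' /= c1.
  - by rewrite c2 d2 => -[].
by rewrite [c]surjective_pairing [d]surjective_pairing E1; congr pair;
  apply: ord_inj; rewrite c2 d2 E1.
Qed.

Lemma is_layer_matching f : f \in matchings B o -> is_layer (matching_layer f).
Proof.
rewrite inE => /andP[/forallP fK _]; apply/andP; split; apply/forallP=> x.
  by apply/implyP; rewrite inE => /andP[].
have fI : injective f by move=> p q E; rewrite -(eqP (fK p)) E (eqP (fK q)).
apply/card_le1_eqP=> -[c1 c2] [d1 d2]; rewrite !inE /uses /=.
case/andP=> /andP[cl /eqP ce] cx /andP[/andP[dl /eqP de] dx].
(* If [x] is the lower channel of one comparator and the upper channel of the other, involutivity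
   makes the second the reversal of the first, against the orientation. *)
case/orP: cx dx ce cl => /eqP<- /orP[] /eqP Ed ce cl.
- by rewrite Ed in ce *; congr pair; apply: channel_port_inj; rewrite -ce -de.
- have := eqP (fK (channel_port d1)); rewrite de -Ed ce => /channel_port_inj E.
  by move: cl; rewrite Ed E ltnNge ltnW.
- have := eqP (fK (channel_port c1)); rewrite ce Ed de => /channel_port_inj E.
  by move: cl; rewrite Ed -E ltnNge ltnW.
- by rewrite Ed in ce *; congr pair; apply: channel_port_inj; apply: fI; rewrite ce de.
Qed.

Lemma matching_network_in f :
  f \in matchings B o -> matching_network f \in two_layer_networks m.
Proof.
move=> fM; rewrite inE /is_network /= is_layer_first is_layer_matching //=.
Qed.

Lemma matching_network_onto C : C \in two_layer_networks m ->
  exists2 f, f \in matchings B o & matching_network f = C.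
Proof.
rewrite inE => /andP[]; case/tupleP: C => L1 C; case/tupleP: C => L C.
rewrite tuple0 /is_network /= => /and3P[_ /andP[/forallP Llt /forallP Luniq] _].
rewrite /tnth /= => /eqP->.
(* [P] joins two ports when some comparator of [L] connects them, in either orientation; it is
   symmetric, and functional because a channel is used at most once. *)
pose P e e' := [exists c : comparator m, [&& c \in L &
   ((channel_port c.1 == e) && (channel_port c.2 == e')) ||
   ((channel_port c.1 == e') && (channel_port c.2 == e))]].
have Psym e e' : P e e' = P e' e by apply: eq_existsb => c; rewrite orbC.
have Puniq e e1 e2 : P e e1 -> P e e2 -> e1 = e2.
  case/existsP=> c /andP[cL ce] /existsP[d /andP[dL de]].
  have [i Ei] : exists i, channel_port i = e.
    by case/orP: ce => /andP[/eqP E1 /eqP E2]; [exists c.1|exists c.2].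
  have /card_le1_eqP U := Luniq i.
  have E : c = d.
    apply: U; rewrite inE ?cL ?dL /uses /= -!(inj_eq channel_port_inj) Ei.
      by case/orP: de => /andP[/eqP-> /eqP->]; rewrite eqxx ?orbT.
    by case/orP: ce => /andP[/eqP-> /eqP->]; rewrite eqxx ?orbT.
  have ltc : c.1 < c.2 by move/implyP: (Llt c) => ->.
  have ne : channel_port c.1 != channel_port c.2.
    by rewrite (inj_eq channel_port_inj) -val_eqE ltn_eqF.
  rewrite -E in de; case/orP: ce de => /andP[/eqP<- /eqP<-] /orP[] /andP[/eqP F1 /eqP F2] //.
    by rewrite F2 eqxx in ne.
  by rewrite F1 eqxx in ne.
have PN e e' : P e e' -> o || (e' != None).
  by case/existsP=> c /andP[_ /orP[] /andP[/eqP A /eqP A']];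
    rewrite -?A -?A'; case: channel_portP => [b l _|o1 _]; rewrite ?orbT ?o1.
(* A port without partner gets the default [e], that is, becomes a fixed point. *)
pose f : matching B := [ffun e => odflt e [pick e' | P e e']].
have fP e : (forall e', ~~ P e e') /\ f e = e \/ P e (f e).
  rewrite ffunE; case: pickP => [e' /= Pe|Pe] /=; [by right|left].
  by split=> // e'; rewrite Pe.
have fE e e' : P e e' -> f e = e'.
  by move=> Pee; case: (fP e) => [[/(_ e')]|]; [rewrite Pee|move/Puniq; apply].
exists f.
  rewrite inE; apply/andP; split.
    apply/forallP=> e; case: (fP e) => [[_ E]|]; first by rewrite !E.
    by rewrite Psym => /fE->.
  case: (fP None) => [[_ ->]|/[dup] /PN]; first by rewrite eqxx orbT.
  by rewrite Psym => PP /PN; rewrite eqxx orbF => ->.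
apply: val_inj; congr [:: _; _]; apply/setP=> c; rewrite !inE.
apply/andP/idP => [[lt /eqP E]|cL].
  have ne : f (channel_port c.1) != channel_port c.1.
    by rewrite E (inj_eq channel_port_inj) -val_eqE gtn_eqF.
  case: (fP (channel_port c.1)) => [[_ E']|]; first by rewrite E' eqxx in ne.
  rewrite E => /existsP[d /andP[dL]]; rewrite !(inj_eq channel_port_inj).
  have ltd : d.1 < d.2 by move/implyP: (Llt d) => ->.
  case/orP=> /andP[/eqP E1 /eqP E2].
    by rewrite [c]surjective_pairing -E1 -E2 -surjective_pairing.
  by move: ltd; rewrite E1 E2 ltnNge ltnW.
split; first by move/implyP: (Llt c) => ->.
by apply/eqP/fE/existsP; exists c; rewrite cL !eqxx.
Qed.

Lemma matching_networkP f : f \in matchings B o ->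
  isomorphic (network_graph (matching_network f)) (mgraph f).
Proof.
move=> fM; have fK : forall e, f (f e) = e.
  by move: fM; rewrite inE => /andP[/forallP H _] e; apply/eqP.
(* A first-layer comparator goes to its block, a second-layer one to its pair of ports. The value
   [inr set0] is a dummy: lower channels of first-layer comparators are block ends. *)
pose h (v : 'I_2 * comparator m) : B + {set port B} :=
  let: (k, c) := v in
  if k == 0 :> nat then
    if channel_port c.1 is Some (b, _) then inl b else inr set0
  else inr [set channel_port c.1; channel_port c.2].
apply: (isomorphic_sig (h := h)).
- case=> [[[|[|//]] lt] c] /=.
    by case/mem_first_layer=> b [-> _].
  rewrite inE => /andP[clt /eqP cf]; apply/existsP; exists (channel_port c.1).
  by rewrite cf eqxx andbT (inj_eq channel_port_inj) -val_eqE gtn_eqF.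
- move=> u v; rewrite unfold_in => uP; rewrite unfold_in => vP; move: u v uP vP.
  move=> [[[|[|//]] lt] c] [[[|[|//]] lt'] d] /=.
  + case/mem_first_layer=> b [c1 c2] /mem_first_layer[b' [d1 d2]].
    rewrite c1 d1 => -[E]; congr pair; first exact: ord_inj.
    rewrite [c]surjective_pairing [d]surjective_pairing.
    by congr pair; apply: channel_port_inj; rewrite ?c1 ?c2 E.
  + by case/mem_first_layer=> b [-> _].
  + by move=> _ /mem_first_layer[b [-> _]].
  + rewrite !inE => /andP[clt _] /andP[dlt _] [/setP E].
    have c1E := E (channel_port c.1); have c2E := E (channel_port c.2).
    move: c1E c2E; rewrite !inE !eqxx /= ?orbT !(inj_eq channel_port_inj).
    move=> /esym/orP c1E /esym/orP c2E; congr pair; first exact: ord_inj.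
    rewrite [c]surjective_pairing [d]surjective_pairing.
    case: c1E c2E clt => /eqP-> [] /eqP->; rewrite ?ltnn // => dlt'.
    by move: dlt; rewrite ltnNge ltnW.
- case=> [b _|A /existsP[e /andP[fe /eqP->]]].
    have [i Ei] := @channel_port_onto (Some (b, false)) (orbT _).
    have [j Ej] := @channel_port_onto (Some (b, true)) (orbT _).
    exists (ord0, (i, j)) => /=; last by rewrite Ei.
    by apply/mem_first_layer; exists b.
  have oe e' : f e' != e' -> o || (e' != None).
    move=> fe'; move: fM; rewrite inE => /andP[_].
    case: (o) => //= /eqP fN; apply/eqP=> e'N.
    by move: fe'; rewrite e'N fN.
  have [i Ei] := channel_port_onto (oe _ fe).
  have [j Ej] : exists j, channel_port j = f e.
    by apply/channel_port_onto/oe; rewrite fK eq_sym.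
  (* The order of the two channels decides which port comes first in the comparator. *)
  have [lt|lt|/ord_inj E] := ltngtP i j; last by rewrite -Ej -E Ei eqxx in fe.
    by exists (ord_max, (i, j)); rewrite /= ?inE /= ?Ei ?Ej ?lt ?eqxx.
  exists (ord_max, (j, i)); rewrite /= ?inE /= ?Ei ?Ej ?lt ?fK ?eqxx //.
  by rewrite setUC.
- move=> l u v u' v' Eu Ev; rewrite /medge Eu Ev /network_edge /uses /vlayer /vcomp.
  (* With two layers, none lies strictly between two others, so the condition is vacuous. *)
  have -> : [forall w : vertex (matching_network f),
     ((val u).1 < (val w).1 < (val v).1) ==>
       ~~ uses (val w).2 (out_channel l (val u).2)].
    apply/forallP=> w; apply/implyP=> /andP[uw wv].
    have := leq_ltn_trans (leq_ltn_trans (leq0n _) uw) wv.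
    by rewrite ltnNge -ltnS (ltn_ord (val v).1).
  rewrite andbT.
  case: u v {Eu Ev} => [[[[|[|//]] ltu] c] uP] [[[[|[|//]] ltv] d] vP] //=.
  + move/mem_first_layer: (uP) => [b [-> _]].
    by move/mem_first_layer: (vP) => [b' [-> _]].
  + move/mem_first_layer: (uP) => [b [c1 c2]]; rewrite c1 !inE.
    rewrite -!(inj_eq channel_port_inj).
    by case: l => /=; rewrite ?c1 ?c2.
Qed.

(** Every network in question comes from a matching with an isomorphic graph, so the two isomorphism
    relations have equally many classes. *)
Lemma r_matchings : r m = #|classes_of (@miso B) (matchings B o)|.
Proof.
have approx_eqv : equivalence_rel (fun C1 C2 : 2.-tuple (layer m) => approx C1 C2).
  by move=> C1 C2 C3; apply: approx_equiv.
rewrite /r card_equivalence_partition //; apply/esym.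
apply: (card_classes_of (@miso_equiv B) approx_eqv (h := matching_network)).
- exact: matching_network_in.
- move=> f g /matching_networkP Hf /matching_networkP Hg; rewrite /approx /miso.
  apply/idP/idP => H.
    apply: isomorphic_trans Hg; apply: isomorphic_trans H.
    by rewrite isomorphic_sym.
  rewrite isomorphic_sym in Hg.
  exact: isomorphic_trans (isomorphic_trans Hf H) Hg.
- move=> C /matching_network_onto[f fM <-]; exists f => //.
  exact: isomorphic_refl.
Qed.

End Channels.

(** * Deleting the block matched to the free port *)

Section RemoveBlock.
Variables (B : finType) (l : bool).

(** The block [b] is arbitrary; a permutation of blocks moves it to the new block [None]. *)
Definition free_to_new : {set matching (option B)} :=
  [set f in matchings (option B) true | [exists b, f None == Some (b, l)]].

(* The block [None : option B] is attached to the free port through its end [l];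
   its other end becomes the free port of the remaining matching. *)
Definition embed_port (e : port B) : port (option B) :=
  if e is Some (b, k) then Some (Some b, k) else Some (None, ~~ l).

(** Inverse to [embed_port] only away from the two ports [None] and [Some (None, l)] that get
    matched to each other. *)
Definition restrict_port (e : port (option B)) : port B :=
  if e is Some (Some b, k) then Some (b, k) else None.

Definition add_block (f : matching B) : matching (option B) :=
  [ffun e => if e == None then Some (None, l)
             else if e == Some (None, l) then None
             else embed_port (f (restrict_port e))].

Lemma embed_portK : cancel embed_port restrict_port.
Proof. by case=> [[]|]. Qed.

Lemma restrict_portK e : e != None -> e != Some (None, l) ->
  embed_port (restrict_port e) = e.
Proof. by case: e => [[[b|] k]|] //= _; case: k l => [] []. Qed.

Lemma embed_port_neq e : (embed_port e != None) && (embed_port e != Some (None, l)).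
Proof. by case: e => [[b k]|] //=; case: l. Qed.

Lemma add_block_embed f e : add_block f (embed_port e) = embed_port (f e).
Proof.
by have /andP[/negbTE n1 /negbTE n2] := embed_port_neq e; rewrite ffunE n1 n2 embed_portK.
Qed.

Lemma add_block_None f : add_block f None = Some (None, l).
Proof. by rewrite ffunE. Qed.

Lemma add_block_new f : add_block f (Some (None, l)) = None.
Proof. by rewrite ffunE eqxx. Qed.

Lemma port_embedP (Q : port (option B) -> Prop) :
  Q None -> Q (Some (None, l)) -> (forall e, Q (embed_port e)) -> forall e, Q e.
Proof.
move=> Q1 Q2 Q3 e; case: (eqVneq e None) => [->//|n1].
by case: (eqVneq e (Some (None, l))) => [->//|n2]; rewrite -(restrict_portK n1 n2).
Qed.

(** [add_block] induces a bijection on classes: a conjugating permutation of [B] extends by fixing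
    the new block, and conversely one between enlarged matchings must fix it. *)
Lemma card_classes_free_to_new :
  #|classes_of (@miso _) free_to_new| = #|classes_of (@miso B) (matchings B true)|.
Proof.
have fMP f : f \in matchings B true -> forall e, f (f e) = e.
  by rewrite inE => /andP[/forallP H _] e; apply/eqP.
have addM f : f \in matchings B true -> add_block f \in free_to_new.
  move=> fM; rewrite !inE andbT; apply/andP; split.
    apply/forallP=> e; apply/eqP; move: e; apply: port_embedP.
    - by rewrite add_block_None add_block_new.
    - by rewrite add_block_new add_block_None.
    - by move=> e; rewrite !add_block_embed fMP.
  by apply/existsP; exists None; rewrite add_block_None.
have addT f : f \in matchings B true -> add_block f \in matchings (option B) true.
  by move/addM; rewrite inE => /andP[].
apply/esym; apply: (card_classes_of (@miso_equiv B) (@miso_equiv _) (h := add_block)).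
- exact: addM.
- move=> f g fM gM; apply/idP/idP; last first.
    case/(isomorphic_conj fM gM) => s sP.
    pose S (x : option B) := omap s x.
    have SI : injective S by move=> [x|] [y|] //= [/perm_inj->].
    have E e : port_map (perm SI) (embed_port e) = embed_port (port_map s e).
      by case: e => [[b k]|] /=; rewrite permE.
    apply: (conj_isomorphic (s := perm SI)); apply: port_embedP => [||e].
    + by rewrite /= !add_block_None /= permE.
    + by rewrite add_block_new /= permE /= add_block_new.
    + by rewrite E !add_block_embed sP E.
  case/(isomorphic_conj (addT f fM) (addT g gM)) => s sP.
  have sN : s None = None.
    by have := sP None; rewrite /= !add_block_None => -[].
  have sS b : s (Some b) = Some (odflt b (s (Some b))).
    by case Es: (s (Some b)) => [//|]; have := perm_inj (etrans Es (esym sN)).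
  have SI : injective (fun b => odflt b (s (Some b))).
    by move=> b c E; have := sS b; rewrite E -sS => /perm_inj[].
  have E e : port_map s (embed_port e) = embed_port (port_map (perm SI) e).
    by case: e => [[b k]|] /=; rewrite ?sN // sS permE.
  apply: (conj_isomorphic (s := perm SI)) => e; apply: (can_inj embed_portK).
  by rewrite -add_block_embed -!E sP add_block_embed.
- move=> h; rewrite !inE andbT => /andP[/forallP hK /existsP[b0 /eqP hN]].
  (* Conjugation by this transposition makes the new block the partner of the free port, so that
     [h1] is an extension by [add_block]. *)
  pose s : {perm option B} := tperm None b0.
  have sK : involutive (port_map s) by case=> [[x k]|] //=; rewrite tpermK.
  pose h1 e := port_map s (h (port_map s e)).
  have h1K e : h1 (h1 e) = e by rewrite /h1 sK (eqP (hK _)) sK.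
  have h1N : h1 None = Some (None, l) by rewrite /h1 /= hN /= tpermR.
  have h1n : h1 (Some (None, l)) = None by rewrite -h1N h1K.
  pose f : matching B := [ffun e => restrict_port (h1 (embed_port e))].
  have fE e : embed_port (f e) = h1 (embed_port e).
    rewrite ffunE; have /andP[n1 n2] := embed_port_neq e; apply: restrict_portK.
      by rewrite -h1n (inj_eq (can_inj h1K)).
    by rewrite -h1N (inj_eq (can_inj h1K)).
  exists f.
    rewrite inE andbT; apply/forallP=> e.
    by rewrite -(inj_eq (can_inj embed_portK)) !fE h1K.
  apply: (conj_isomorphic (s := s)) => e; rewrite -[LHS]sK -/(h1 e); congr port_map.
  move: e; apply: port_embedP => [||e].
  + by rewrite h1N add_block_None.
  + by rewrite h1n add_block_new.
  + by rewrite add_block_embed fE.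
Qed.

End RemoveBlock.

(** * The recurrence *)

(** Whether the free port is matched, and the label of the end it is matched to, are therefore
    isomorphism invariants. This separates the three families counted below. *)
Lemma miso_free (B : finType) (f g : matching B) :
    f \in matchings B true -> g \in matchings B true -> miso f g ->
  exists s : {perm B}, g None = port_map s (f None).
Proof. by move=> fM gM /(isomorphic_conj fM gM)[s /(_ None)]; exists s. Qed.

Lemma card_classes_matchings (B : finType) :
  #|classes_of (@miso _) (matchings (option B) true)| =
  #|classes_of (@miso _) (matchings (option B) false)| +
  2 * #|classes_of (@miso B) (matchings B true)|.
Proof.
have -> : matchings (option B) true =
    matchings (option B) false :|: (free_to_new B false :|: free_to_new B true).
  apply/setP=> f; rewrite !inE /= -!andb_orr andbT; case: forallP => //= _.
  case: (f None) => [[b l]|] //=; apply/esym/orP.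
  by case: l; [right|left]; apply/existsP; exists b.
rewrite card_classes_ofU; first 1 last.
- exact: miso_equiv.
- move=> f g fM gM; apply/negP=> fg.
  have gT : g \in matchings (option B) true.
    by move: gM; rewrite !inE => /orP[] /andP[].
  have [s] := miso_free (matchingsT fM) gT fg.
  move: fM gM; rewrite !inE => /andP[_ /eqP->] /orP[] /andP[_ /existsP[b /eqP->]] //.
congr (_ + _); rewrite card_classes_ofU; first 1 last.
- exact: miso_equiv.
- move=> f g; rewrite !inE => /andP[fT /existsP[b /eqP fN]] /andP[gT /existsP[c /eqP gN]].
  apply/negP=> /miso_free[|| s]; rewrite ?inE // fN gN //.
by rewrite !card_classes_free_to_new mul2n addnn.
Qed.

Theorem theorem2 (n : nat) (n_odd : odd n) (n_ge3 : 3 <= n) :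
  r n = r (n - 1) + 2 * r (n - 2).
Proof.
(* As [n >= 3], there is at least one block; [option 'I_k] serves as block set for [n] and [n - 1],
   and ['I_k] for [n - 2]. *)
have [k ->] : exists k, n = k.+1.*2.+1.
  exists n./2.-1; rewrite prednK ?half_gt0 ?(ltnW n_ge3) //.
  by rewrite -{1}(odd_double_half n) n_odd.
have card_opt : #|{: option 'I_k}| = k.+1 by rewrite card_option card_ord.
rewrite subn1 doubleS !subSS subn0 -doubleS -pred_Sn.
have rE (B : finType) (o : bool) j : #|B| = j ->
    r (o + j.*2) = #|classes_of (@miso B) (matchings B o)|.
  by move<-; apply: r_matchings.
have -> : r k.+1.*2.+1 = _ := rE _ true _ card_opt.
have -> : r k.+1.*2 = _ := rE _ false _ card_opt.
have -> : r k.*2.+1 = _ := rE _ true _ (card_ord k).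
exact: card_classes_matchings.
Qed.
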